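(* Let $a\in R$. If $a\in R^{WD}$ (i.e. $a$ is weak Drazin invertible), then $a\in R^{d}$ (i.e. $a$ is Drazin invertible).
   Context: $R$ is a proper unital ring with involution: an associative ring with $1$ and a map $*:R\to R$ with $(a+b)^*=a^*+b^*$, $(ab)^*=b^*a^*$, $(a^* )^*=a$, such that $a^*a=0$ implies $a=0$. Weak Drazin (WD) inverse: $a\in R$ is WD invertible if there are $x\in R$ and a positive integer $k$ with $axa=a$, $a^{k+1}x=a^k$, $xa^{k+1}=a^k$. The least positive integer $k$ for which such an $x$ exists is the weak Drazin index $\mathrm{ind}(a)$; any $x$ satisfying the three equations with $k=\mathrm{ind}(a)$ is a WD inverse of $a$ (not unique in general). $R^{WD}$ is the set of WD invertible elements. Drazin inverse: $a\in R$ is Drazin invertible if there is $x\in R$ with $xa^{k+1}=a^k$, $ax=xa$, $ax^2=x$ for some positive integer $k$; $R^d$ is the set of Drazin invertible elements. *)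

(* Defs.v *)
From mathcomp Require Import all_boot all_algebra.

Set Implicit Arguments.
Unset Strict Implicit.
Unset Printing Implicit Defensive.

Import GRing.Theory.
Local Open Scope ring_scope.

Definition ring_involution (R : pzRingType) (star : R -> R) : Prop :=
  [/\ forall a b, star (a + b) = star a + star b,
      forall a b, star (a * b) = star b * star a
    & forall a, star (star a) = a].

Definition proper_involution (R : pzRingType) (star : R -> R) : Prop :=
  ring_involution star /\ forall a, star a * a = 0 -> a = 0.

Definition WD_equations (R : pzRingType) (a x : R) (k : nat) : Prop :=
  [/\ a * x * a = a, a ^+ k.+1 * x = a ^+ k & x * a ^+ k.+1 = a ^+ k].

Definition WD_invertible (R : pzRingType) (a : R) : Prop :=
  exists (x : R) (k : nat), (0 < k)%N /\ WD_equations a x k.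

Definition Drazin_equations (R : pzRingType) (a x : R) (k : nat) : Prop :=
  [/\ x * a ^+ k.+1 = a ^+ k, a * x = x * a & a * x ^+ 2 = x].

Definition Drazin_invertible (R : pzRingType) (a : R) : Prop :=
  exists (x : R) (k : nat), (0 < k)%N /\ Drazin_equations a x k.

(* Main.v *)
(* From [a^(k+1) x = a^k = x a^(k+1)] one gets [a^k x = x a^(k+1) x = x a^k],
   so [x] commutes with [a^k] although not with [a]; then [x^(k+1) a^k] is a
   Drazin inverse of [a]. *)
Require Import Defs.
From mathcomp Require Import all_boot all_algebra.

Import GRing.Theory.
Local Open Scope ring_scope.

(** With [y = x^(k+1) a^k], multiplying by [a] on either side cancels one [x], so
    [a y = x^k a^k = y a]. The other two equations hold because surplus powers of [a] absorb powers
    of [x] ([left_power_absorb]). *)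

Lemma left_power_absorb (R : pzRingType) (a x : R) (k n : nat) :
  x * a ^+ k.+1 = a ^+ k -> x ^+ n * a ^+ (k + n) = a ^+ k.
Proof.
move=> xa; elim: n => [|n IHn]; first by rewrite expr0 mul1r addn0.
by rewrite exprSr addnS -addSn exprD -mulrA (mulrA x) xa -exprD.
Qed.

Theorem corollary2p1 (R : pzRingType) (star : R -> R)
    (star_proper : proper_involution star) (a : R) :
  WD_invertible a -> Drazin_invertible a.
Proof.
move=> [x [k [k_gt0 [_ ax xa]]]].
have cxa : GRing.comm x (a ^+ k) by rewrite /GRing.comm -{1}ax mulrA xa.
have cXa n : a ^+ k * x ^+ n = x ^+ n * a ^+ k.
  by apply: commrX; apply: commr_sym.
have ad : a * (x ^+ k.+1 * a ^+ k) = x ^+ k * a ^+ k.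
  by rewrite -cXa mulrA -exprS (exprS x) mulrA ax cXa.
exists (x ^+ k.+1 * a ^+ k), k; split=> //; split.
- by rewrite -mulrA -exprD addnS -addnS; apply: left_power_absorb.
- by rewrite ad -mulrA -exprSr exprSr -mulrA xa.
(* Flipping [y] to [a^k x^(k+1)] merges the two [a^k] into [a^(k+k)], which absorbs [x^k]. *)
- rewrite expr2 mulrA ad -(cXa k.+1) mulrA -(mulrA (x ^+ k)) -exprD.
  by rewrite left_power_absorb.
Qed.
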